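(* Let $\mathfrak{g}$ be a Lie algebra and let $H=(\mathfrak{g}^{D_3})_0$ be the Lie group with operation (for $d\in D_3$) $$\left(dX_1+\tfrac12 d^2X_2+\tfrac16 d^3X_3\right)*\left(dY_1+\tfrac12 d^2Y_2+\tfrac16 d^3Y_3\right)=d(X_1+Y_1)+\tfrac12 d^2\left(X_2+Y_2+[X_1,Y_1]\right)+\tfrac16 d^3\left\{X_3+Y_3+\tfrac32\left([X_1,Y_2]+[X_2,Y_1]\right)+\tfrac12[X_1-Y_1,[X_1,Y_1]]\right\}.$$ For $X_1,X_2,X_3,Y_1,Y_2,Y_3\in\mathfrak{g}$ consider the elements of the Lie algebra of $H$ (tangent vectors $D\to H$ at the unit element $0$) $$e\mapsto\left(d\mapsto deX_1+\tfrac12 d^2eX_2+\tfrac16d^3eX_3\right),\qquad e\mapsto\left(d\mapsto deY_1+\tfrac12 d^2eY_2+\tfrac16d^3eY_3\right)\qquad(e\in D,\ d\in D_3).$$ Then their Lie bracket in the Lie algebra of $H$ is $$e\mapsto\left(d\mapsto d^2e[X_1,Y_1]+\tfrac12d^3e\left([X_1,Y_2]+[X_2,Y_1]\right)\right).$$ This agrees with the bracket of $dX_1+\tfrac12d^2X_2+\tfrac16d^3X_3$ and $dY_1+\tfrac12d^2Y_2+\tfrac16d^3Y_3$ computed pointwise in the Lie algebra $\mathfrak{g}^{D_3}$.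
   Context: The setting is synthetic differential geometry (SDG; intuitionistic reasoning). $\mathbb{R}$ is the line, a commutative unital $\mathbb{Q}$-algebra satisfying the general Kock–Lawvere axiom for all Weil algebras. $D_n=\{d\in\mathbb{R}\mid d^{n+1}=0\}$ and $D=D_1$. A space $M$ is microlinear if $M^{(-)}$ sends to a limit diagram every finite diagram of infinitesimal spaces (spectra of Weil algebras) with cocone that $\mathbb{R}^{(-)}$ sends to a limit diagram. An $\mathbb{R}$-module $\mathbb{E}$ is Euclidean if for each $f:D\to\mathbb{E}$ there is a unique $b\in\mathbb{E}$ with $f(d)=f(0)+db$ for all $d\in D$. A Lie algebra is a Euclidean $\mathbb{R}$-module, microlinear as a space, with a bilinear, antisymmetric bracket satisfying the Jacobi identity. $(\mathfrak{g}^{D_n})_0=\{f\in\mathfrak{g}^{D_n}\mid f(0)=0\}$; elements for $n=3$ are uniquely $d\mapsto dX_1+\tfrac12d^2X_2+\tfrac16d^3X_3$. A Lie group is a group $H$ that is microlinear as a space; its Lie algebra is $\{X:D\to H\mid X(0)=\text{unit}\}$ with bracket characterized by $[X,Y](e_1e_2)=X(e_1)Y(e_2)X(-e_1)Y(-e_2)$ for $e_1,e_2\in D$ (product in $H$). *)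

(* Defs.v *)
From Stdlib Require Import QArith Ring Ring_theory List Fin Lia.
From Stdlib Require Import FunctionalExtensionality ProofIrrelevance.

Set Implicit Arguments.
Unset Strict Implicit.
Unset Printing Implicit Defensive.

Record CRing := {
  car :> Type;
  r0 : car; r1 : car;
  radd : car -> car -> car;
  rmul : car -> car -> car;
  rsub : car -> car -> car;
  ropp : car -> car;
  cr_laws : ring_theory r0 r1 radd rmul rsub ropp (@eq car) }.
Arguments r0 {c}.
Arguments r1 {c}.
Arguments ropp {c} _.

Declare Scope sdg_scope.
Delimit Scope sdg_scope with S.
Bind Scope sdg_scope with car.
Notation "0" := r0 : sdg_scope.
Notation "1" := r1 : sdg_scope.
Notation "x + y" := (radd x y) : sdg_scope.
Notation "x * y" := (rmul x y) : sdg_scope.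
Notation "x - y" := (rsub x y) : sdg_scope.
Notation "- x" := (ropp x) : sdg_scope.
Local Open Scope sdg_scope.

Fixpoint rpow (A : CRing) (x : A) (n : nat) : A :=
  match n with O => 1 | S m => x * rpow x m end.
Notation "x ^ n" := (rpow x n%nat) : sdg_scope.

Definition rhom (A B : CRing) (f : A -> B) : Prop :=
  f 1 = 1 /\ (forall x y, f (x + y) = f x + f y)
  /\ (forall x y, f (x * y) = f x * f y).

Record QAlgebra := {
  qring :> CRing;
  ofQ : Q -> qring;
  ofQ_morph : ring_morph r0 r1 (@radd qring) (@rmul qring) (@rsub qring)
    (@ropp qring) (@eq qring) 0%Q 1%Q Qplus Qmult Qminus Qopp Qeq_bool ofQ }.

Record RModule (R : CRing) := {
  mcar :> Type;
  m0 : mcar;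
  madd : mcar -> mcar -> mcar;
  mopp : mcar -> mcar;
  smul : R -> mcar -> mcar;
  maddA : forall u v w, madd u (madd v w) = madd (madd u v) w;
  maddC : forall u v, madd u v = madd v u;
  madd0 : forall u, madd u m0 = u;
  maddN : forall u, madd u (mopp u) = m0;
  smulA : forall r s u, smul r (smul s u) = smul (r * s) u;
  smul1 : forall u, smul 1 u = u;
  smulDl : forall r s u, smul (r + s) u = madd (smul r u) (smul s u);
  smulDr : forall r u v, smul r (madd u v) = madd (smul r u) (smul r v) }.
Arguments m0 {_ _}.
Arguments mopp {_ _} _.

Declare Scope module_scope.
Delimit Scope module_scope with M.
Bind Scope module_scope with mcar.
Notation "0" := m0 : module_scope.
Notation "u + v" := (madd u v) : module_scope.
Notation "- u" := (mopp u) : module_scope.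
Notation "u - v" := (madd u (mopp v)) : module_scope.
Notation "r *: u" := (smul r%S u%M)
  (at level 40, left associativity) : module_scope.

Fixpoint rsum (A : CRing) (n : nat) (f : nat -> A) : A :=
  match n with O => 0 | S m => rsum m f + f m end.

(* A Weil algebra over R: as an R-module it is R.1 (+) I with I, the kernel
   of the augmentation, nilpotent and free on
   wbasis 0, ..., wbasis (wdim - 1). *)
Record WeilAlgebra (R : CRing) := {
  wring :> CRing;
  wconst : R -> wring;
  wconst_hom : rhom wconst;
  waug : wring -> R;
  waug_hom : rhom waug;
  waug_const : forall r, waug (wconst r) = r;
  wdim : nat;
  wbasis : nat -> wring;
  waug_basis : forall i, (i < wdim)%nat -> waug (wbasis i) = 0;
  wcoord : wring -> nat -> R;
  wcoord_sum : forall w, w = wconst (waug w)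
     + rsum wdim (fun i => wconst (wcoord w i) * wbasis i);
  wcoord_uniq : forall (c : nat -> R) j, (j < wdim)%nat ->
     wcoord (rsum wdim (fun i => wconst (c i) * wbasis i)) j = c j;
  wnilp : exists k, forall l : list wring, length l = k ->
     Forall (fun x => waug x = 0) l -> fold_right (@rmul wring) 1 l = 0 }.

Definition Spec (R : CRing) (W : WeilAlgebra R) : Type :=
  {phi : W -> R | rhom phi /\ forall r, phi (wconst W r) = r}.

(* "There is a unique x with P x", as data: intuitionistic type theory has no
   function comprehension turning a proposition [exists! x, P x] into an
   element, whereas the internal logic of a topos has. *)
Definition unique_exists (A : Type) (P : A -> Prop) : Type :=
  {x : A | unique P x}.
Notation "'exists1' x : A , P" := (unique_exists (fun x : A => P))
  (at level 200, x name, right associativity).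

(* The axiom is only meaningful intuitionistically: a function on
   {d | d^2 = 0} deciding whether d = 0 forces 1 = 0 in R.  This is why the
   algebraic structures here do not carry a decidable equality. *)
Record Line := {
  lring :> QAlgebra;
  kock_lawvere : forall (W : WeilAlgebra lring) (f : Spec W -> lring),
    exists1 w : W, forall phi : Spec W, f phi = proj1_sig phi w }.

Definition D (R : CRing) (n : nat) : Type := {d : R | d ^ S n = 0}.
Definition Dval (R : CRing) (n : nat) (d : D R n) : R := proj1_sig d.
Coercion Dval : D >-> car.

Section Infinitesimals.
Variable A : CRing.
Add Ring A_ring : (cr_laws A).

Lemma D0_proof n : (0 : A) ^ S n = 0.
Proof. cbn [rpow]. ring. Qed.

Lemma Dopp_proof (d : D A 1) : (- (d : A)) ^ 2 = 0.
Proof. destruct d as [d h]; cbn [rpow Dval proj1_sig] in *. ring [h]. Qed.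

Lemma Dmul_proof (d e : D A 1) : ((d : A) * e) ^ 2 = 0.
Proof.
destruct d as [d h], e as [e k]; cbn [rpow Dval proj1_sig] in *. ring [h k].
Qed.

Lemma D_eq n (d e : D A n) : (d : A) = e -> d = e.
Proof.
destruct d as [d h], e as [e k]; cbn [Dval proj1_sig]; intros; subst.
f_equal; apply proof_irrelevance.
Qed.

Definition D0 n : D A n := exist _ 0 (D0_proof n).
Definition Dopp (d : D A 1) : D A 1 := exist _ (- (d : A)) (Dopp_proof d).
Definition Dmul (d e : D A 1) : D A 1 := exist _ ((d : A) * e) (Dmul_proof d e).
End Infinitesimals.
Arguments D0 {A n}.

Definition Euclidean (R : CRing) (E : RModule R) : Type :=
  forall f : D R 1 -> E,
  exists1 b : E, forall d : D R 1, f d = (f D0 + (d : R) *: b)%M.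

Record Cocone (R : CRing) := {
  nvert : nat;
  narr : nat;
  vert : Fin.t nvert -> WeilAlgebra R;
  src : Fin.t narr -> Fin.t nvert;
  tgt : Fin.t narr -> Fin.t nvert;
  arr : forall a : Fin.t narr, Spec (vert (src a)) -> Spec (vert (tgt a));
  apex : WeilAlgebra R;
  leg : forall i : Fin.t nvert, Spec (vert i) -> Spec apex;
  leg_arr : forall (a : Fin.t narr) (x : Spec (vert (src a))),
    @leg (tgt a) (@arr a x) = @leg (src a) x }.

Arguments vert {R} c i.
Arguments src {R} c a.
Arguments tgt {R} c a.
Arguments arr {R} c a x.
Arguments leg {R} c i x.

(* [M^(-)] sends the cocone to a limit cone. *)
Definition limit_in (R : CRing) (c : Cocone R) (M : Type) : Type :=
  forall f : forall i, Spec (vert c i) -> M,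
  (forall a x, f (tgt c a) (arr c a x) = f (src c a) x) ->
  exists1 h : (Spec (apex c) -> M), forall i x, h (leg c i x) = f i x.

Definition Microlinear (R : Line) (M : Type) : Type :=
  forall c : Cocone R, limit_in c R -> limit_in c M.

Record LieAlgebra (R : Line) := {
  lmod :> RModule R;
  br : lmod -> lmod -> lmod;
  brDl : forall X Y Z, br (X + Y)%M Z = (br X Z + br Y Z)%M;
  brDr : forall X Y Z, br X (Y + Z)%M = (br X Y + br X Z)%M;
  brZl : forall r X Y, br (r *: X)%M Y = (r *: br X Y)%M;
  brZr : forall r X Y, br X (r *: Y)%M = (r *: br X Y)%M;
  brC : forall X Y, br X Y = (- br Y X)%M;
  jacobi : forall X Y Z,
    (br X (br Y Z) + br Y (br Z X) + br Z (br X Y))%M = m0;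
  lie_euclidean : Euclidean lmod;
  lie_microlinear : Microlinear R lmod }.
Notation "[ X , Y ]" := (br X%M Y%M) : module_scope.

Record LieGroup (R : Line) := {
  gcar :> Type;
  gmul : gcar -> gcar -> gcar;
  gone : gcar;
  ginv : gcar -> gcar;
  gmulA : forall x y z, gmul x (gmul y z) = gmul (gmul x y) z;
  gmul1 : forall x, gmul x gone = x;
  gone1 : forall x, gmul gone x = x;
  gmulV : forall x, gmul x (ginv x) = gone;
  gVmul : forall x, gmul (ginv x) x = gone;
  group_microlinear : Microlinear R gcar }.
Arguments gone {R l}.
Declare Scope group_scope.
Delimit Scope group_scope with G.
Notation "x * y" := (gmul x y) : group_scope.

Definition Tangent1 (R : Line) (G : LieGroup R) : Type :=
  {X : D R 1 -> G | X D0 = gone}.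
Definition tangent_fun (R : Line) (G : LieGroup R) (X : Tangent1 G) :
  D R 1 -> G := proj1_sig X.
Coercion tangent_fun : Tangent1 >-> Funclass.

(* [Z] is the Lie bracket [X, Y] of tangent vectors at the unit of G. *)
Definition is_group_bracket (R : Line) (G : LieGroup R)
    (X Y Z : Tangent1 G) : Prop :=
  unique (fun Z : Tangent1 G => forall e1 e2 : D R 1,
    Z (Dmul e1 e2) = (X e1 * Y e2 * X (Dopp e1) * Y (Dopp e2))%G) Z.

Ltac qcst t :=
  match t with
  | ofQ _ ?q => constr:(q)
  | _ => constr:(InitialRing.NotConstant)
  end.

(* Linear identities in a module E are decided by [ring] in the square-zero
   extension R (+) E. *)
Section SquareZero.
Variables (R : QAlgebra) (E : RModule R).
Add Ring R_ring : (cr_laws R) (morphism (ofQ_morph R), constants [qcst]).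
Local Open Scope module_scope.

Lemma madd0l (u : E) : 0 + u = u.
Proof. rewrite maddC. apply madd0. Qed.

Lemma maddI (u v w : E) : u + v = u + w -> v = w.
Proof.
intros h. rewrite <- (madd0l v), <- (madd0l w), <- (maddN u).
rewrite (maddC u (- u)), <- !maddA, h. reflexivity.
Qed.

Lemma smul0l (u : E) : 0 *: u = 0.
Proof.
apply (@maddI (0 *: u)). rewrite <- smulDl, madd0.
f_equal; ring.
Qed.

Lemma smul0r (r : R) : r *: (0 : E) = 0.
Proof.
apply (@maddI (r *: 0)). rewrite <- smulDr, !madd0. reflexivity.
Qed.

Lemma maddACA (u v w x : E) : (u + v) + (w + x) = (u + w) + (v + x).
Proof.
rewrite <- !maddA. f_equal. rewrite !maddA, (maddC v). reflexivity.
Qed.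

Definition te_ring : CRing.
Proof.
refine (@Build_CRing (R * E)%type (r0, m0) (r1, m0)
  (fun x y => (radd (fst x) (fst y), madd (snd x) (snd y)))
  (fun x y => (rmul (fst x) (fst y),
               madd (smul (fst x) (snd y)) (smul (fst y) (snd x))))
  (fun x y => (rsub (fst x) (fst y), madd (snd x) (mopp (snd y))))
  (fun x => (ropp (fst x), mopp (snd x))) _).
split.
- intros [a u]; cbn. f_equal; [ring | apply madd0l].
- intros [a u] [b v]; cbn. f_equal; [ring | apply maddC].
- intros [a u] [b v] [c w]; cbn. f_equal; [ring | apply maddA].
- intros [a u]; cbn. f_equal; [ring |].
  rewrite smul1, smul0r, madd0. reflexivity.
- intros [a u] [b v]; cbn. f_equal; [ring | apply maddC].
- intros [a u] [b v] [c w]; cbn. f_equal; [ring |].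
  rewrite !smulDr, !smulA, <- maddA. f_equal; f_equal; f_equal; ring.
- intros [a u] [b v] [c w]; cbn. f_equal; [ring |].
  rewrite smulDl, smulDr. apply maddACA.
- intros [a u] [b v]; cbn. f_equal; ring.
- intros [a u]; cbn. f_equal; [ring | apply maddN].
Defined.

Lemma te_ofQ : ring_morph r0 r1 (@radd te_ring) (@rmul te_ring)
  (@rsub te_ring) (@ropp te_ring) (@eq te_ring) 0%Q 1%Q Qplus Qmult Qminus
  Qopp Qeq_bool (fun q => (ofQ R q, m0)).
Proof.
destruct (ofQ_morph R) as [h0 h1 hD hB hM hN hE].
assert (hN0 : - (0 : E) = 0) by (rewrite <- (madd0l (- 0)); apply maddN).
split; cbn; intros.
- f_equal; apply h0.
- f_equal; apply h1.
- rewrite madd0. f_equal; apply hD.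
- rewrite hN0, madd0. f_equal; apply hB.
- rewrite !smul0r, madd0. f_equal; apply hM.
- rewrite hN0. f_equal; apply hN.
- f_equal; apply hE; assumption.
Qed.

Definition te : QAlgebra := Build_QAlgebra te_ofQ.
Definition iE (u : E) : te := (r0, u).
Definition iR (r : R) : te := (r, m0).

Lemma iE_inj u v : iE u = iE v -> u = v.
Proof. intros h. exact (f_equal snd h). Qed.
Lemma iE0 : iE 0 = r0.
Proof. reflexivity. Qed.
Lemma iED u v : iE (u + v) = radd (iE u) (iE v).
Proof. unfold iE; cbn. f_equal; ring. Qed.
Lemma iEN u : iE (- u) = ropp (iE u).
Proof. unfold iE; cbn. f_equal; ring. Qed.
Lemma iEZ r u : iE (r *: u) = rmul (iR r) (iE u).
Proof. unfold iE, iR; cbn. rewrite smul0r, madd0. f_equal; ring. Qed.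
Lemma iRD r s : iR (radd r s) = radd (iR r) (iR s).
Proof. unfold iR; cbn. rewrite madd0; reflexivity. Qed.
Lemma iRM r s : iR (rmul r s) = rmul (iR r) (iR s).
Proof. unfold iR; cbn. rewrite !smul0r, madd0; reflexivity. Qed.
Lemma iRN r : iR (ropp r) = ropp (iR r).
Proof.
unfold iR; cbn. f_equal. rewrite <- (madd0l (- 0)); symmetry; apply maddN.
Qed.
Lemma iRB r s : iR (rsub r s) = rsub (iR r) (iR s).
Proof.
unfold iR; cbn. f_equal. symmetry; apply maddN.
Qed.
Lemma iR0 : iR r0 = r0.
Proof. reflexivity. Qed.
Lemma iR1 : iR r1 = r1.
Proof. reflexivity. Qed.
Lemma iRQ q : iR (ofQ R q) = ofQ te q.
Proof. reflexivity. Qed.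
End SquareZero.

Ltac te_push :=
  apply iE_inj; cbn [rpow];
  repeat rewrite ?iED, ?iEN, ?iEZ, ?iE0, ?iRD, ?iRM, ?iRN, ?iRB, ?iR0, ?iR1, ?iRQ.

Section EuclideanModules.
Variables (R : QAlgebra) (E : RModule R) (euc : Euclidean E).
Add Ring R_ring2 : (cr_laws R) (morphism (ofQ_morph R), constants [qcst]).
Add Ring te_ring2 : (cr_laws (te E)) (morphism (ofQ_morph (te E)), constants [qcst]).
Local Open Scope module_scope.

Lemma eucl_inj (u v : E) : (forall d : D R 1, (d : R) *: u = (d : R) *: v) -> u = v.
Proof.
intros h. destruct (euc (fun d => (d : R) *: u)) as [b [_ hb]].
transitivity b; [symmetry|]; apply hb; intros d; cbn [Dval D0 proj1_sig];
  [| rewrite h]; te_push; ring.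
Qed.

Lemma eucl_inj2 (u v : E) :
  (forall d e : D R 1, (d * e)%S *: u = (d * e)%S *: v) -> u = v.
Proof.
intros h. apply eucl_inj; intros d. apply eucl_inj; intros e.
rewrite !smulA. apply h.
Qed.

Definition es1 (x y z : R) : R := (x + y + z)%S.
Definition es2 (x y z : R) : R := (x * y + x * z + y * z)%S.
Definition es3 (x y z : R) : R := (x * y * z)%S.
Definition sym_poly (a0 a1 a2 a3 : E) (x y z : R) : E :=
  a0 + es1 x y z *: a1 + es2 x y z *: a2 + es3 x y z *: a3.

Lemma multilinear3 (f : D R 1 -> D R 1 -> D R 1 -> E) :
  (forall x y z, f x y z = f y x z) -> (forall x y z, f x y z = f x z y) ->
  {a : E * E * E * E | forall x y z : D R 1,
     f x y z = sym_poly (fst (fst (fst a))) (snd (fst (fst a))) (snd (fst a)) (snd a) x y z}.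
Proof.
intros s12 s23.
pose (B x y := proj1_sig (euc (fun z => f x y z))).
assert (hB : forall x y z : D R 1, f x y z = f x y D0 + (z : R) *: B x y).
{ intros x y z. exact (proj1 (proj2_sig (euc (fun z => f x y z))) z). }
pose (A1 x := proj1_sig (euc (fun y => f x y D0))).
assert (hA1 : forall x y : D R 1, f x y D0 = f x D0 D0 + (y : R) *: A1 x).
{ intros x y. exact (proj1 (proj2_sig (euc (fun y => f x y D0))) y). }
pose (B1 x := proj1_sig (euc (fun y => B x y))).
assert (hB1 : forall x y : D R 1, B x y = B x D0 + (y : R) *: B1 x).
{ intros x y. exact (proj1 (proj2_sig (euc (fun y => B x y))) y). }
pose (a1 := proj1_sig (euc (fun x => f x D0 D0))).
assert (h1 : forall x : D R 1, f x D0 D0 = f D0 D0 D0 + (x : R) *: a1).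
{ intros x. exact (proj1 (proj2_sig (euc (fun x => f x D0 D0))) x). }
pose (a2 := proj1_sig (euc A1)).
assert (h2 : forall x : D R 1, A1 x = A1 D0 + (x : R) *: a2).
{ intros x. exact (proj1 (proj2_sig (euc A1)) x). }
pose (a2' := proj1_sig (euc (fun x => B x D0))).
assert (h2' : forall x : D R 1, B x D0 = B D0 D0 + (x : R) *: a2').
{ intros x. exact (proj1 (proj2_sig (euc (fun x => B x D0))) x). }
pose (a3 := proj1_sig (euc B1)).
assert (h3 : forall x : D R 1, B1 x = B1 D0 + (x : R) *: a3).
{ intros x. exact (proj1 (proj2_sig (euc B1)) x). }
assert (e1 : A1 D0 = a1).
{ apply eucl_inj; intros d. apply (@maddI R E (f D0 D0 D0)).
  rewrite <- hA1, <- h1. apply s12. }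
assert (e2 : B D0 D0 = a1).
{ rewrite <- e1. apply eucl_inj; intros d. apply (@maddI R E (f D0 D0 D0)).
  rewrite <- hA1, <- hB. apply s23. }
assert (e3 : a2' = a2).
{ apply eucl_inj2; intros d e. apply (@maddI R E (f D0 D0 D0 + es1 d e r0 *: a1)).
  transitivity (f d D0 e).
  - rewrite (hB d D0 e), (h1 d), (h2' d), e2. unfold es1. te_push; ring.
  - rewrite (s23 d D0 e), (hA1 d e), (h1 d), (h2 d), e1. unfold es1. te_push; ring. }
assert (e4 : B1 D0 = a2).
{ apply eucl_inj2; intros d e. apply (@maddI R E (f D0 D0 D0 + es1 d e r0 *: a1)).
  transitivity (f D0 d e).
  - rewrite (hB D0 d e), (hA1 D0 d), (hB1 D0 d), e2, e1. unfold es1. te_push; ring.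
  - rewrite (s12 D0 d e), (s23 d D0 e), (hA1 d e), (h1 d), (h2 d), e1. unfold es1. te_push; ring. }
exists (f D0 D0 D0, a1, a2, a3). intros x y z; cbn [fst snd].
rewrite hB, hA1, hB1, h1, h2, h2', h3, e1, e2, e3, e4.
unfold sym_poly, es1, es2, es3. te_push; ring.
Qed.

Lemma sym_poly_inj a0 a1 a2 a3 b0 b1 b2 b3 :
  (forall x y z : D R 1, sym_poly a0 a1 a2 a3 x y z = sym_poly b0 b1 b2 b3 x y z) ->
  a0 = b0 /\ a1 = b1 /\ a2 = b2 /\ a3 = b3.
Proof.
intros h.
assert (h0 : a0 = b0).
{ generalize (h D0 D0 D0). unfold sym_poly, es1, es2, es3; cbn [Dval D0 proj1_sig].
  intros k. transitivity (sym_poly a0 a1 a2 a3 r0 r0 r0).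
  - unfold sym_poly, es1, es2, es3. te_push; ring.
  - unfold sym_poly, es1, es2, es3. rewrite k. te_push; ring. }
subst b0.
assert (h1 : a1 = b1).
{ apply eucl_inj; intros d. apply (@maddI R E a0).
  generalize (h d D0 D0). unfold sym_poly, es1, es2, es3; cbn [Dval D0 proj1_sig].
  intros k. transitivity (sym_poly a0 a1 a2 a3 d r0 r0).
  - unfold sym_poly, es1, es2, es3. te_push; ring.
  - unfold sym_poly, es1, es2, es3. rewrite k. te_push; ring. }
subst b1.
assert (h2 : a2 = b2).
{ apply eucl_inj2; intros d e. apply (@maddI R E (a0 + (d + e)%S *: a1)).
  generalize (h d e D0). unfold sym_poly, es1, es2, es3; cbn [Dval D0 proj1_sig].
  intros k. transitivity (sym_poly a0 a1 a2 a3 d e r0).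
  - unfold sym_poly, es1, es2, es3. te_push; ring.
  - unfold sym_poly, es1, es2, es3. rewrite k. te_push; ring. }
subst b2.
repeat split.
apply eucl_inj2; intros d e. apply eucl_inj; intros x.
apply (@maddI R E (a0 + es1 d e x *: a1 + es2 d e x *: a2)).
generalize (h d e x). unfold sym_poly. intros k.
transitivity (sym_poly a0 a1 a2 a3 d e x).
- unfold sym_poly, es3. te_push; ring.
- unfold sym_poly. rewrite k. unfold es3. te_push; ring.
Qed.
End EuclideanModules.
Section Dual.
Variable A : CRing.
Add Ring A_ring3 : (cr_laws A).

Definition dual_ring : CRing.
Proof.
refine (@Build_CRing (A * A)%type (r0, r0) (r1, r0)
  (fun x y => (radd (fst x) (fst y), radd (snd x) (snd y)))
  (fun x y => (rmul (fst x) (fst y),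
               radd (rmul (fst x) (snd y)) (rmul (snd x) (fst y))))
  (fun x y => (rsub (fst x) (fst y), rsub (snd x) (snd y)))
  (fun x => (ropp (fst x), ropp (snd x))) _).
split; intros; cbn; repeat match goal with x : (_ * _)%type |- _ => destruct x end;
  cbn; repeat apply (f_equal2 pair); ring.
Defined.

Definition trunc4_ring : CRing.
Proof.
refine (@Build_CRing (A * A * A * A)%type (r0, r0, r0, r0) (r1, r0, r0, r0)
  (fun x y => let '(a, b, c, d) := x in let '(a', b', c', d') := y in
     (a + a', b + b', c + c', d + d'))
  (fun x y => let '(a, b, c, d) := x in let '(a', b', c', d') := y in
     (a * a', a * b' + b * a', a * c' + b * b' + c * a',
      a * d' + b * c' + c * b' + d * a'))
  (fun x y => let '(a, b, c, d) := x in let '(a', b', c', d') := y in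
     (a - a', b - b', c - c', d - d'))
  (fun x => let '(a, b, c, d) := x in (- a, - b, - c, - d)) _).
split; intros; cbn; repeat match goal with x : (_ * _)%type |- _ => destruct x end;
  cbn; repeat apply (f_equal2 pair); ring.
Defined.
End Dual.

Section WeilExamples.
Variable R : CRing.
Add Ring R_ring3 : (cr_laws R).

Ltac tuples :=
  repeat match goal with x : _ |- _ =>
    match type of x with
    | car (dual_ring _) => destruct x as [? ?]
    | car (trunc4_ring _) => destruct x as [[[? ?] ?] ?]
    | (_ * _)%type => destruct x as [? ?]
    end end.
Ltac list_nil :=
  match goal with
  | h : length ?l = O |- _ => destruct l; [clear h | discriminate h]
  | h : length ?l = S _ |- _ => destruct l; [discriminate h | injection h; clear h; intros h]
  end.
Ltac foralls :=
  repeat match goal with h : Forall _ (_ :: _) |- _ =>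
    inversion_clear h end.

Definition dual_weil : WeilAlgebra R.
Proof.
refine (@Build_WeilAlgebra R (dual_ring R) (fun r => (r, r0)) _
  (fun w => fst w) _ _ 1 (fun _ => (r0, r1)) _ (fun w _ => snd w) _ _ _).
- repeat split; intros; cbn; repeat apply (f_equal2 pair); ring.
- repeat split; intros; cbn; ring.
- reflexivity.
- reflexivity.
- intros w; tuples; cbn. repeat apply (f_equal2 pair); ring.
- intros c j h. assert (j = 0%nat) by lia; subst; cbn. ring.
- exists 2%nat. intros l h hl. do 3 list_nil. foralls. tuples. cbn in *. subst.
  repeat apply (f_equal2 pair); ring.
Defined.

Definition trunc4_weil : WeilAlgebra R.
Proof.
refine (@Build_WeilAlgebra R (trunc4_ring R) (fun r => (r, r0, r0, r0)) _
  (fun w => let '(a, b, c, d) := w in a) _ _ 3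
  (fun i => match i with
            | 0%nat => (r0, r1, r0, r0)
            | 1%nat => (r0, r0, r1, r0)
            | _ => (r0, r0, r0, r1) end) _
  (fun w i => let '(a, b, c, d) := w in
     match i with 0%nat => b | 1%nat => c | _ => d end) _ _ _).
- repeat split; intros; cbn; repeat apply (f_equal2 pair); ring.
- repeat split; intros; tuples; cbn; ring.
- reflexivity.
- intros i _. destruct i as [|[|i]]; reflexivity.
- intros w; tuples; cbn. repeat apply (f_equal2 pair); ring.
- intros c j h. destruct j as [|[|[|j]]]; [| | | lia]; cbn; ring.
- exists 4%nat. intros l h hl. do 5 list_nil. foralls. tuples. cbn in *. subst.
  repeat apply (f_equal2 pair); ring.
Defined.

Definition cube_ring : CRing := dual_ring (dual_ring (dual_ring R)).

Definition cube_weil : WeilAlgebra R.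
Proof.
refine (@Build_WeilAlgebra R cube_ring
  (fun r => (((r, r0), (r0, r0)), ((r0, r0), (r0, r0)))) _
  (fun w => fst (fst (fst w))) _ _ 7
  (fun i => match i with
     | 0%nat => (((r0, r1), (r0, r0)), ((r0, r0), (r0, r0)))
     | 1%nat => (((r0, r0), (r1, r0)), ((r0, r0), (r0, r0)))
     | 2%nat => (((r0, r0), (r0, r1)), ((r0, r0), (r0, r0)))
     | 3%nat => (((r0, r0), (r0, r0)), ((r1, r0), (r0, r0)))
     | 4%nat => (((r0, r0), (r0, r0)), ((r0, r1), (r0, r0)))
     | 5%nat => (((r0, r0), (r0, r0)), ((r0, r0), (r1, r0)))
     | _ => (((r0, r0), (r0, r0)), ((r0, r0), (r0, r1))) end) _
  (fun w i => match i with
     | 0%nat => snd (fst (fst w))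
     | 1%nat => fst (snd (fst w))
     | 2%nat => snd (snd (fst w))
     | 3%nat => fst (fst (snd w))
     | 4%nat => snd (fst (snd w))
     | 5%nat => fst (snd (snd w))
     | _ => snd (snd (snd w)) end) _ _ _).
- repeat split; intros; cbn; repeat apply (f_equal2 pair); ring.
- repeat split; intros; cbn; ring.
- reflexivity.
- intros i _. do 6 (destruct i as [|i]; [reflexivity|]). reflexivity.
- intros w. cbn in w. tuples; cbn. repeat apply (f_equal2 pair); ring.
- intros c j h. do 7 (destruct j as [|j]; [cbn; ring|]). lia.
- exists 4%nat. intros l h hl. do 5 list_nil. foralls. cbn in *. tuples.
  cbn in *. subst. repeat apply (f_equal2 pair); ring.
Defined.

Lemma Spec_eq (W : WeilAlgebra R) (p q : Spec W) :
  (forall w, proj1_sig p w = proj1_sig q w) -> p = q.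
Proof.
intros h. destruct p as [p hp], q as [q hq]; cbn in h.
assert (p = q) by (apply functional_extensionality; exact h); subst q.
f_equal; apply proof_irrelevance.
Qed.

Lemma square_pt (W : WeilAlgebra R) (p : Spec W) (w : W) :
  w * w = 0 -> (proj1_sig p w) ^ 2 = 0.
Proof.
destruct p as [p [[h1 [hD hM]] hr]]; cbn [proj1_sig rpow]. intros hw.
transitivity (p w * p w); [ring |]. rewrite <- hM, hw.
transitivity (p (wconst W 0)); [| apply hr]. apply (f_equal p).
destruct (wconst_hom W) as [k1 [kD kM]].
generalize (kD 0 0) (cr_laws W). intros e L.
replace ((0 : R) + 0) with (0 : R) in e by ring.
destruct L.
assert (c : forall u v : W, u = u + v -> v = 0).
{ intros u v h. rewrite <- (Radd_0_l v), <- (Ropp_def u), (Radd_comm u).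
  rewrite <- Radd_assoc, <- h, Radd_comm. reflexivity. }
symmetry. exact (c _ _ e).
Qed.

Definition dual_x (p : Spec dual_weil) : D R 1.
Proof.
exists (proj1_sig p (r0, r1)). apply square_pt. cbn.
repeat apply (f_equal2 pair); ring.
Defined.

Definition dual_pt (d : D R 1) : Spec dual_weil.
Proof.
exists (fun w => fst w + snd w * d). destruct d as [d h]; cbn in *.
repeat split; intros; cbn; ring [h].
Defined.

Definition trunc4_pt (d : D R 3) : Spec trunc4_weil.
Proof.
exists (fun w => let '(a, b, c, e) := w in a + b * d + c * (d * d) + e * (d * d * d)).
destruct d as [d h]; cbn in *.
repeat split; intros; tuples; cbn; ring [h].
Defined.

Definition trunc4_x (p : Spec trunc4_weil) : D R 3.
Proof.
exists (proj1_sig p (r0, r1, r0, r0)).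
destruct p as [p [[h1 [hD hM]] hr]]; cbn [proj1_sig rpow].
rewrite <- h1, <- !hM. 
transitivity (p (r0, r0, r0, r0)); [apply (f_equal p); cbn; repeat apply (f_equal2 pair); ring |].
apply hr.
Defined.

Definition cube_pt (x y z : D R 1) : Spec cube_weil.
Proof.
exists (fun w =>
  fst (fst (fst w)) + snd (fst (fst w)) * z
  + (fst (snd (fst w)) + snd (snd (fst w)) * z) * y
  + (fst (fst (snd w)) + snd (fst (snd w)) * z
  + (fst (snd (snd w)) + snd (snd (snd w)) * z) * y) * x).
destruct x as [x hx], y as [y hy], z as [z hz]; cbn in *.
repeat split; intros; cbn in *; ring [hx hy hz].
Defined.

Definition cube_gx : cube_weil := (((r0, r0), (r0, r0)), ((r1, r0), (r0, r0))).
Definition cube_gy : cube_weil := (((r0, r0), (r1, r0)), ((r0, r0), (r0, r0))).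
Definition cube_gz : cube_weil := (((r0, r1), (r0, r0)), ((r0, r0), (r0, r0))).

Definition cube_x (p : Spec cube_weil) : D R 1.
Proof.
exists (proj1_sig p cube_gx). apply square_pt. cbn. repeat apply (f_equal2 pair); ring.
Defined.
Definition cube_y (p : Spec cube_weil) : D R 1.
Proof.
exists (proj1_sig p cube_gy). apply square_pt. cbn. repeat apply (f_equal2 pair); ring.
Defined.
Definition cube_z (p : Spec cube_weil) : D R 1.
Proof.
exists (proj1_sig p cube_gz). apply square_pt. cbn. repeat apply (f_equal2 pair); ring.
Defined.

Lemma cube_ptK p : cube_pt (cube_x p) (cube_y p) (cube_z p) = p.
Proof.
apply Spec_eq; intros [[[a b] [c d]] [[e f] [g i]]].
destruct p as [p [[h1 [hD hM]] hr]].
cbn [proj1_sig cube_pt cube_x cube_y cube_z Dval fst snd].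
pose (k := wconst cube_weil).
transitivity (p (k a + k b * cube_gz + (k c + k d * cube_gz) * cube_gy
  + (k e + k f * cube_gz + (k g + k i * cube_gz) * cube_gy) * cube_gx)).
- repeat rewrite ?hD, ?hM. unfold k. rewrite !hr. reflexivity.
- apply (f_equal p). cbn. repeat apply (f_equal2 pair); ring.
Qed.

Lemma trunc4_ptK p : trunc4_pt (trunc4_x p) = p.
Proof.
apply Spec_eq; intros [[[a b] c] d].
destruct p as [p [[h1 [hD hM]] hr]]; cbn [proj1_sig trunc4_pt trunc4_x Dval].
pose (k := wconst trunc4_weil). pose (x := (r0, r1, r0, r0) : trunc4_weil).
transitivity (p (k a + k b * x + k c * (x * x) + k d * (x * x * x))).
- repeat rewrite ?hD, ?hM. unfold k. rewrite !hr. reflexivity.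
- apply (f_equal p). cbn. repeat apply (f_equal2 pair); ring.
Qed.

Lemma cube_xK x y z : cube_x (cube_pt x y z) = x.
Proof. apply D_eq; cbn. ring. Qed.
Lemma cube_yK x y z : cube_y (cube_pt x y z) = y.
Proof. apply D_eq; cbn. ring. Qed.
Lemma cube_zK x y z : cube_z (cube_pt x y z) = z.
Proof. apply D_eq; cbn. ring. Qed.
Lemma trunc4_xK d : trunc4_x (trunc4_pt d) = d.
Proof. apply D_eq; cbn. ring. Qed.

Definition Dsum3 (x y z : D R 1) : D R 3.
Proof.
exists ((x : R) + y + z).
destruct x as [x hx], y as [y hy], z as [z hz]; cbn in *. ring [hx hy hz].
Defined.
End WeilExamples.
Definition self_module (A : CRing) : RModule A.
Proof.
refine (@Build_RModule A A r0 (@radd A) ropp (@rmul A) _ _ _ _ _ _ _ _);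
  intros; destruct (cr_laws A).
- apply Radd_assoc.
- apply Radd_comm.
- rewrite Radd_comm. apply Radd_0_l.
- apply Ropp_def.
- apply Rmul_assoc.
- apply Rmul_1_l.
- apply Rdistr_l.
- rewrite !(Rmul_comm r). apply Rdistr_l.
Defined.

Section CubicFunctions.
Variable R : Line.
Add Ring R_ring4 : (cr_laws R) (morphism (ofQ_morph R), constants [qcst]).

Lemma self_euclidean : Euclidean (self_module R).
Proof.
intros f.
destruct (@kock_lawvere R (dual_weil R)
  (fun p => (f (dual_x p) : car R))) as [[a b] [h hu]].
assert (hf : forall d : D R 1, f d = a + b * d).
{ intros d. generalize (h (dual_pt d)); cbn. intros <-. f_equal.
  apply D_eq; cbn. ring. }
assert (ha : f D0 = a) by (rewrite hf; cbn; ring).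
exists b. split.
- intros d. rewrite ha, hf. cbn. ring.
- intros b' hb'. cut ((a, b) = (a, b')); [congruence |].
  apply hu. intros p. cbn.
  rewrite hb', ha. destruct p as [p [[h1 [hD hM]] hr]]; cbn.
  pose (k := wconst (dual_weil R)).
  transitivity (p (k a + k b' * ((r0, r1) : dual_weil R))).
  + rewrite hD, hM. unfold k. rewrite !hr. cbn. ring.
  + apply (f_equal p). cbn. repeat apply (f_equal2 pair); ring.
Qed.

Definition swap12 (p : Spec (cube_weil R)) : Spec (cube_weil R) :=
  cube_pt (cube_y p) (cube_x p) (cube_z p).
Definition swap23 (p : Spec (cube_weil R)) : Spec (cube_weil R) :=
  cube_pt (cube_x p) (cube_z p) (cube_y p).
Definition sum_leg (p : Spec (cube_weil R)) : Spec (trunc4_weil R) :=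
  trunc4_pt (Dsum3 (cube_x p) (cube_y p) (cube_z p)).

Definition swap (a : Fin.t 2) : Spec (cube_weil R) -> Spec (cube_weil R) :=
  match a with Fin.F1 => swap12 | Fin.FS _ => swap23 end.

(* D^3 -> D_3, (x, y, z) |-> x + y + z, as the quotient of D^3 by the
   permutations of coordinates. *)
Definition sum_cocone : Cocone R.
Proof.
refine (@Build_Cocone R 1 2 (fun _ => cube_weil R) (fun _ => Fin.F1)
  (fun _ => Fin.F1) swap
  (trunc4_weil R) (fun _ => sum_leg) _).
intros a p. unfold sum_leg. f_equal. apply D_eq.
assert (hq : swap a p = swap12 p \/ swap a p = swap23 p)
  by (clear; unfold swap; destruct a; auto).
destruct hq as [-> | ->]; unfold swap12, swap23;
  rewrite cube_xK, cube_yK, cube_zK; cbn [Dsum3 Dval proj1_sig]; ring.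
Defined.


Lemma sum_limitP (M : Type) :
  (forall f : D R 1 -> D R 1 -> D R 1 -> M,
    (forall x y z, f x y z = f y x z) -> (forall x y z, f x y z = f x z y) ->
    exists1 h : (D R 3 -> M), forall x y z, h (Dsum3 x y z) = f x y z) ->
  limit_in sum_cocone M.
Proof.
intros H f hf.
destruct (H (fun x y z => f Fin.F1 (cube_pt x y z))) as [h [hh hu]].
- intros x y z. generalize (hf Fin.F1 (cube_pt x y z)). cbn. unfold swap12.
  rewrite cube_xK, cube_yK, cube_zK. auto.
- intros x y z. generalize (hf (Fin.FS Fin.F1) (cube_pt x y z)). cbn. unfold swap23.
  rewrite cube_xK, cube_yK, cube_zK. auto.
- exists (fun p => h (trunc4_x p)). split.
  + intros i x. cbn in i. pattern i; apply Fin.caseS'; [| intros j; apply Fin.case0; exact j].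
    cbn. unfold sum_leg. rewrite trunc4_xK, hh, cube_ptK. reflexivity.
  + intros h' hh'. apply functional_extensionality; intros p.
    rewrite (hu (fun d => h' (trunc4_pt d))).
    * rewrite trunc4_ptK. reflexivity.
    * intros x y z. rewrite <- hh'. cbn. unfold sum_leg.
      rewrite cube_xK, cube_yK, cube_zK. reflexivity.
Qed.

Lemma sum_limitE (M : Type) : limit_in sum_cocone M ->
  forall h h' : D R 3 -> M,
  (forall x y z, h (Dsum3 x y z) = h' (Dsum3 x y z)) -> h = h'.
Proof.
intros H h h' e.
destruct (H (fun _ p => h (trunc4_x (sum_leg p)))) as [k [_ hk]].
{ intros a x. f_equal. f_equal. exact (@leg_arr _ sum_cocone a x). }
apply functional_extensionality; intros d.
assert (e1 : k = fun p => h (trunc4_x p)).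
{ apply hk. reflexivity. }
assert (e2 : k = fun p => h' (trunc4_x p)).
{ apply hk. intros i x. cbn. unfold sum_leg. rewrite trunc4_xK. symmetry; apply e. }
rewrite <- (trunc4_xK d).
transitivity (k (trunc4_pt d)); [rewrite e1 | rewrite e2]; reflexivity.
Qed.

Definition cubic (E : RModule R) (X0 X1 X2 X3 : E) (d : R) : E :=
  (X0 + d *: X1 + (ofQ R (1#2) * d ^ 2) *: X2
   + (ofQ R (1#6) * d ^ 3) *: X3)%M.

Section Cubic.
Variable E : RModule R.
Hypothesis euc : Euclidean E.
Add Ring te_ring4 : (cr_laws (te E)) (morphism (ofQ_morph (te E)), constants [qcst]).

Lemma iR_sq0 (x : D R 1) : iR E x * iR E x = 0.
Proof.
rewrite <- iRM. destruct x as [x h]; cbn in *. unfold iR. f_equal.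
rewrite <- h. ring.
Qed.

Lemma cubic_sum (X0 X1 X2 X3 : E) (x y z : D R 1) :
  cubic X0 X1 X2 X3 (Dsum3 x y z) = sym_poly X0 X1 X2 X3 x y z.
Proof.
unfold cubic, sym_poly, es1, es2, es3. cbn [Dsum3 Dval proj1_sig rpow].
generalize (iR_sq0 x) (iR_sq0 y) (iR_sq0 z). intros hx hy hz.
change (proj1_sig x) with (Dval x); change (proj1_sig y) with (Dval y);
change (proj1_sig z) with (Dval z).
te_push. ring [hx hy hz].
Qed.

Lemma cubic_inj (X0 X1 X2 X3 Y0 Y1 Y2 Y3 : E) :
  (forall d : D R 3, cubic X0 X1 X2 X3 d = cubic Y0 Y1 Y2 Y3 d) ->
  X0 = Y0 /\ X1 = Y1 /\ X2 = Y2 /\ X3 = Y3.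
Proof.
intros h. apply (sym_poly_inj euc). intros x y z.
rewrite <- !cubic_sum. apply h.
Qed.
End Cubic.

Lemma sum_limit_line : limit_in sum_cocone R.
Proof.
pose (E := self_module R).
apply sum_limitP. intros f s12 s23.
destruct (@multilinear3 R E self_euclidean f s12 s23) as [[[[a0 a1] a2] a3] ha].
cbn [fst snd] in ha.
exists (fun d : D R 3 => cubic (a0 : E) a1 a2 a3 d). split.
- intros x y z. rewrite ha. exact (@cubic_sum E a0 a1 a2 a3 x y z).
- intros h hh. apply functional_extensionality; intros d.
  destruct (@kock_lawvere R (trunc4_weil R) (fun p => h (trunc4_x p)))
    as [[[[b0 b1] b2] b3] [hb _]].
  assert (hb' : forall d : D R 3, h d =
    cubic (b0 : E) b1 (ofQ R 2 * b2 : E) (ofQ R 6 * b3 : E) d).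
  { intros e. generalize (hb (trunc4_pt e)). rewrite trunc4_xK. intros ->.
    cbn. ring. }
  destruct (@sym_poly_inj R E self_euclidean a0 a1 a2 a3 b0 b1
     (ofQ R 2 * b2) (ofQ R 6 * b3)) as [-> [-> [-> ->]]].
  + intros x y z. rewrite <- ha, <- hh, hb'.
    exact (@cubic_sum E b0 b1 (ofQ R 2 * b2) (ofQ R 6 * b3) x y z).
  + symmetry; apply hb'.
Qed.

Lemma cubic_exists (E : RModule R) (euc : Euclidean E)
  (mic : Microlinear R E) (F : D R 3 -> E) :
  {X : E * E * E | forall d : D R 3,
     F d = cubic (F D0) (fst (fst X)) (snd (fst X)) (snd X) d}.
Proof.
destruct (@multilinear3 R E euc (fun x y z => F (Dsum3 x y z))) as [[[[a0 a1] a2] a3] ha].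
- intros x y z. f_equal; apply D_eq; cbn; ring.
- intros x y z. f_equal; apply D_eq; cbn; ring.
- cbn [fst snd] in ha.
  assert (hF : F = fun d => cubic a0 a1 a2 a3 d).
  { apply (sum_limitE (mic _ sum_limit_line)). intros x y z.
    rewrite ha. symmetry; apply cubic_sum. }
  assert (h0 : F D0 = a0).
  { rewrite hF. unfold cubic. cbn [Dval D0 proj1_sig rpow].
    rewrite <- (madd0 a0) at 2. rewrite <- !maddA. f_equal.
    assert (z : forall r, r = 0 -> forall u : E, (r *: u)%M = m0)
      by (intros r -> u; apply smul0l).
    rewrite !z, !madd0; try reflexivity; ring. }
  exists (a1, a2, a3). cbn [fst snd]. intros d. rewrite h0, hF. reflexivity.
Qed.
End CubicFunctions.
Section Exponential.
Variables (R : Line) (A : Type) (g : LieAlgebra R).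
Local Open Scope module_scope.

Lemma microlinear_exp (M : Type) : Microlinear R M -> Microlinear R (A -> M).
Proof.
intros mic c lim f hf.
pose (h a := mic c lim (fun i x => f i x a) (fun b x => f_equal (fun k => k a) (hf b x))).
exists (fun p a => proj1_sig (h a) p). split.
- intros i x. apply functional_extensionality; intros a.
  exact (proj1 (proj2_sig (h a)) i x).
- intros h' hh'. apply functional_extensionality; intros p.
  apply functional_extensionality; intros a.
  apply (f_equal (fun k => k p) (x := proj1_sig (h a)) (y := fun p => h' p a)).
  apply (proj2 (proj2_sig (h a))). intros i x. rewrite hh'. reflexivity.
Qed.

Definition exp_module : RModule R.
Proof.
refine (@Build_RModule R (A -> g) (fun _ => 0)
  (fun F G a => F a + G a) (fun F a => - F a) (fun r F a => r *: F a)
  _ _ _ _ _ _ _ _); intros; apply functional_extensionality; intros a.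
- apply maddA.
- apply maddC.
- apply madd0.
- apply maddN.
- apply smulA.
- apply smul1.
- apply smulDl.
- apply smulDr.
Defined.

Lemma exp_euclidean : Euclidean exp_module.
Proof.
intros f.
pose (h a := lie_euclidean (fun d => f d a)).
exists (fun a => proj1_sig (h a)). split.
- intros d. apply functional_extensionality; intros a.
  exact (proj1 (proj2_sig (h a)) d).
- intros b hb. apply functional_extensionality; intros a.
  apply (proj2 (proj2_sig (h a))). intros d. exact (f_equal (fun k => k a) (hb d)).
Qed.

(* The Lie algebra g^A, with the pointwise bracket. *)
Definition exp_lie : LieAlgebra R.
Proof.
refine (@Build_LieAlgebra R exp_module (fun F G a => [F a, G a]) _ _ _ _ _ _
  exp_euclidean (microlinear_exp (@lie_microlinear R g)));
  intros; apply functional_extensionality; intros a; cbn.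
- apply brDl.
- apply brDr.
- apply brZl.
- apply brZr.
- apply brC.
- apply jacobi.
Defined.
End Exponential.

(* (g^{D_n})_0 *)
Definition Exp0 (R : Line) (g : LieAlgebra R) (n : nat) : Type :=
  {F : D R n -> g | F D0 = m0}.
Definition exp0_fun (R : Line) (g : LieAlgebra R) (n : nat) (F : Exp0 g n) :
  D R n -> g := proj1_sig F.
Coercion exp0_fun : Exp0 >-> Funclass.

Section JetGroup.
Variables (R : Line) (g : LieAlgebra R).
Add Ring R_ring5 : (cr_laws R) (morphism (ofQ_morph R), constants [qcst]).
Add Ring te_ring5 : (cr_laws (te g)) (morphism (ofQ_morph (te g)), constants [qcst]).
Local Open Scope module_scope.

Lemma exp0_eq n (F G : Exp0 g n) : (forall d, F d = G d) -> F = G.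
Proof.
intros h. destruct F as [F hF], G as [G hG]; cbn in h.
assert (F = G) by (apply functional_extensionality; exact h); subst G.
f_equal; apply proof_irrelevance.
Qed.

Lemma microlinear_exp0 n : Microlinear R (Exp0 g n).
Proof.
intros c lim f hf.
assert (hf' : forall a x, exp0_fun (f (tgt c a) (arr c a x)) = f (src c a) x)
  by (intros; f_equal; apply hf).
destruct (@microlinear_exp R (D R n) g (@lie_microlinear R g) c lim
  (fun i x => f i x) hf') as [h [hh hu]].
assert (h0 : forall p, h p D0 = 0).
{ destruct (@lie_microlinear R g c lim (fun _ _ => 0) (fun _ _ => eq_refl))
    as [k [_ hk]].
  intros p. transitivity (k p).
  - symmetry. apply (f_equal (fun k => k p) (x := k) (y := fun p => h p D0)).
    apply hk. intros i x. rewrite hh. exact (proj2_sig (f i x)).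
  - apply (f_equal (fun k => k p) (x := k) (y := fun p => 0)).
    apply hk. reflexivity. }
exists (fun p => exist _ (h p) (h0 p)). split.
- intros i x. apply exp0_eq; intros d. cbn. rewrite hh. reflexivity.
- intros h' hh'. apply functional_extensionality; intros p.
  apply exp0_eq; intros d. cbn.
  rewrite (hu (fun p => h' p)); [reflexivity |].
  intros i x. rewrite hh'. reflexivity.
Qed.

Definition jet_fun (X1 X2 X3 : g) (d : R) : g :=
  d *: X1 + (ofQ R (1#2) * d ^ 2) *: X2 + (ofQ R (1#6) * d ^ 3) *: X3.

Lemma jet_fun0 (X1 X2 X3 : g) : jet_fun X1 X2 X3 (D0 : D R 3) = 0.
Proof.
unfold jet_fun; cbn [Dval D0 proj1_sig]. te_push. ring.
Qed.

Definition jet (X1 X2 X3 : g) : Exp0 g 3 :=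
  exist (fun F : D R 3 -> g => F D0 = 0) (fun d => jet_fun X1 X2 X3 d)
    (jet_fun0 X1 X2 X3).

Lemma jet_cubic X1 X2 X3 (d : R) : jet_fun X1 X2 X3 d = cubic 0 X1 X2 X3 d.
Proof. unfold jet_fun, cubic. te_push. ring. Qed.

Lemma jet_inj X1 X2 X3 Y1 Y2 Y3 :
  jet X1 X2 X3 = jet Y1 Y2 Y3 -> X1 = Y1 /\ X2 = Y2 /\ X3 = Y3.
Proof.
intros h. apply (@cubic_inj R g (@lie_euclidean R g) 0 X1 X2 X3 0 Y1 Y2 Y3).
intros d. rewrite <- !jet_cubic.
exact (f_equal (fun F : Exp0 g 3 => F d) h).
Qed.

Lemma jet_exists (F : Exp0 g 3) :
  {X : g * g * g | F = jet (fst (fst X)) (snd (fst X)) (snd X)}.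
Proof.
destruct (cubic_exists (@lie_euclidean R g) (@lie_microlinear R g) F) as [X hX].
exists X. apply exp0_eq; intros d. rewrite hX. cbn. rewrite jet_cubic.
f_equal. exact (proj2_sig F).
Qed.

Definition coef1 (F : Exp0 g 3) : g := fst (fst (proj1_sig (jet_exists F))).
Definition coef2 (F : Exp0 g 3) : g := snd (fst (proj1_sig (jet_exists F))).
Definition coef3 (F : Exp0 g 3) : g := snd (proj1_sig (jet_exists F)).

Lemma jetK F : jet (coef1 F) (coef2 F) (coef3 F) = F.
Proof. symmetry. exact (proj2_sig (jet_exists F)). Qed.

Lemma coefK X1 X2 X3 :
  coef1 (jet X1 X2 X3) = X1 /\ coef2 (jet X1 X2 X3) = X2
  /\ coef3 (jet X1 X2 X3) = X3.
Proof. apply jet_inj, jetK. Qed.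

Definition jet_mul_coefs (X1 X2 X3 Y1 Y2 Y3 : g) : Exp0 g 3 :=
  jet (X1 + Y1)
      (X2 + Y2 + [X1, Y1])
      (X3 + Y3 + ofQ R (3#2) *: ([X1, Y2] + [X2, Y1])
         + ofQ R (1#2) *: [X1 - Y1, [X1, Y1]]).

Definition jet_mul (F G : Exp0 g 3) : Exp0 g 3 :=
  jet_mul_coefs (coef1 F) (coef2 F) (coef3 F) (coef1 G) (coef2 G) (coef3 G).

Lemma jet_mulE X1 X2 X3 Y1 Y2 Y3 :
  jet_mul (jet X1 X2 X3) (jet Y1 Y2 Y3) = jet_mul_coefs X1 X2 X3 Y1 Y2 Y3.
Proof.
unfold jet_mul.
destruct (coefK X1 X2 X3) as [-> [-> ->]], (coefK Y1 Y2 Y3) as [-> [-> ->]].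
reflexivity.
Qed.

Lemma brNl (X Y : g) : [- X, Y] = - [X, Y].
Proof.
apply (@maddI R g [X, Y]). rewrite maddN, <- brDl, maddN.
rewrite <- (smul0l (0 : g)), brZl. te_push. ring.
Qed.
Lemma brNr (X Y : g) : [X, - Y] = - [X, Y].
Proof. rewrite brC, brNl, (brC Y X). te_push. ring. Qed.
Lemma brXX (X : g) : [X, X] = 0.
Proof.
assert (h : (iE [X, X] = - iE [X, X])%S) by (rewrite <- iEN; f_equal; apply brC).
apply iE_inj. rewrite iE0.
transitivity (ofQ (te g) (1#2) * (iE [X, X] + iE [X, X]))%S; [ring |].
rewrite h at 1. ring.
Qed.
Lemma br0l (X : g) : [0, X] = 0.
Proof. rewrite <- (smul0l (0 : g)), brZl. te_push. ring. Qed.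
Lemma br0r (X : g) : [X, 0] = 0.
Proof. rewrite <- (smul0l (0 : g)), brZr. te_push. ring. Qed.
End JetGroup.

Ltac br_push := rewrite ?brDl, ?brDr, ?brNl, ?brNr, ?brZl, ?brZr, ?brXX, ?br0l, ?br0r.

Section JetGroupLaws.
Variables (R : Line) (g : LieAlgebra R).
Add Ring R_ring6 : (cr_laws R) (morphism (ofQ_morph R), constants [qcst]).
Add Ring te_ring6 : (cr_laws (te g)) (morphism (ofQ_morph (te g)), constants [qcst]).
Local Open Scope module_scope.

Lemma jet_mulA (F G K : Exp0 g 3) :
  jet_mul F (jet_mul G K) = jet_mul (jet_mul F G) K.
Proof.
rewrite <- (jetK F), <- (jetK G), <- (jetK K).
generalize (coef1 F) (coef2 F) (coef3 F) (coef1 G) (coef2 G) (coef3 G)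
  (coef1 K) (coef2 K) (coef3 K). clear.
intros X1 X2 X3 Y1 Y2 Y3 Z1 Z2 Z3.
rewrite !jet_mulE. unfold jet_mul_coefs. rewrite !jet_mulE. unfold jet_mul_coefs.
f_equal.
- te_push. ring.
- repeat progress br_push. te_push. ring.
- assert (J : [[X1, Y1], Z1] = [X1, [Y1, Z1]] - [Y1, [X1, Z1]]).
  { apply (@maddI R g [Z1, [X1, Y1]]). rewrite (brC [X1, Y1] Z1), maddN.
    rewrite <- (jacobi X1 Y1 Z1), (brC Z1 X1), brNr. te_push. ring. }
  assert (J' : [Z1, [X1, Y1]] = [Y1, [X1, Z1]] - [X1, [Y1, Z1]])
    by (rewrite brC, J; te_push; ring).
  repeat progress br_push. rewrite J, J'. te_push. ring.
Qed.

Lemma jet_mul0 (F : Exp0 g 3) : jet_mul F (jet 0 0 0) = F.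
Proof.
rewrite <- (jetK F), jet_mulE. unfold jet_mul_coefs.
f_equal; repeat progress br_push; te_push; ring.
Qed.

Lemma jet_0mul (F : Exp0 g 3) : jet_mul (jet 0 0 0) F = F.
Proof.
rewrite <- (jetK F), jet_mulE. unfold jet_mul_coefs.
f_equal; repeat progress br_push; te_push; ring.
Qed.

Definition jet_inv (F : Exp0 g 3) : Exp0 g 3 :=
  jet (- coef1 F) (- coef2 F) (- coef3 F).

Lemma jet_mulV (F : Exp0 g 3) : jet_mul F (jet_inv F) = jet 0 0 0.
Proof.
rewrite <- (jetK F) at 1. unfold jet_inv. rewrite jet_mulE. unfold jet_mul_coefs.
rewrite (brC (coef2 F) (- coef1 F)).
f_equal; repeat progress br_push; te_push; ring.
Qed.

Lemma jet_Vmul (F : Exp0 g 3) : jet_mul (jet_inv F) F = jet 0 0 0.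
Proof.
rewrite <- (jetK F) at 2. unfold jet_inv. rewrite jet_mulE. unfold jet_mul_coefs.
rewrite (brC (- coef2 F) (coef1 F)).
f_equal; repeat progress br_push; te_push; ring.
Qed.

(* The Lie group (g^{D_3})_0; see [jet_mulE] for its operation. *)
Definition jet_group : LieGroup R :=
  Build_LieGroup jet_mulA jet_mul0 jet_0mul jet_mulV jet_Vmul
    (@microlinear_exp0 R g 3).

Definition jet_tangent_fun (X1 X2 X3 : g) (e : R) (d : R) : g :=
  (d * e)%S *: X1 + (ofQ R (1#2) * d ^ 2 * e)%S *: X2
  + (ofQ R (1#6) * d ^ 3 * e)%S *: X3.

Lemma jet_tangent_fun0 (X1 X2 X3 : g) (e : R) :
  jet_tangent_fun X1 X2 X3 e (D0 : D R 3) = 0.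
Proof.
unfold jet_tangent_fun; cbn [Dval D0 proj1_sig]. te_push. ring.
Qed.

Lemma jet_tangent_unit (X1 X2 X3 : g) :
  exist (fun F : D R 3 -> g => F D0 = 0)
    (fun d => jet_tangent_fun X1 X2 X3 (D0 : D R 1) d)
    (jet_tangent_fun0 X1 X2 X3 (D0 : D R 1)) = gone :> jet_group.
Proof.
apply exp0_eq; intros d. cbn. unfold jet_tangent_fun, jet_fun. cbn [rpow].
te_push. ring.
Qed.

Definition jet_tangent (X1 X2 X3 : g) : Tangent1 jet_group :=
  exist (fun X : D R 1 -> jet_group => X D0 = gone)
    (fun e => exist (fun F : D R 3 -> g => F D0 = 0)
       (fun d => jet_tangent_fun X1 X2 X3 e d)
       (jet_tangent_fun0 X1 X2 X3 e))
    (jet_tangent_unit X1 X2 X3).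
End JetGroupLaws.

(* Main.v *)
Require Import Defs.
From Stdlib Require Import QArith Ring FunctionalExtensionality ProofIrrelevance.

(** The tangent vectors at hand are scaled jets, [jet_tangent X1 X2 X3 e =
    jet (e *: X1) (e *: X2) (e *: X3)], so their commutator is computed in the
    coefficients of jets.  The linear terms cancel, as does everything that
    involves only [e1] or only [e2].  Since [e1 ^ 2 = e2 ^ 2 = 0], only simple
    brackets of one coefficient of X with one of Y remain: a double bracket of
    first coefficients contains two X's or two Y's, hence a square.  The
    commutator is therefore the jet whose coefficients are [e1 * e2] times
    0, [2 [X1, Y1]] and [3 ([X1, Y2] + [X2, Y1])] ([jet_tangent_commutator]).
    Against the weights 1/2 and 1/6 of [jet], the factors 2 and 3 give the
    weights 1 and 1/2 of the stated bracket.

    A tangent vector is determined by its values at the products [e1 * e2],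
    although an element of [D R 1] need not be such a product: pointwise in
    [d], it is an affine function of [e] with values in the Euclidean module
    [g], and a coefficient is detected by its multiples by [e1 * e2]
    ([eq_on_products], [group_bracket_of_commutator]).

    In the pointwise bracket of the two jets, everything beyond the third
    order in [d] vanishes because [d ^ 4 = 0], and the two terms of third order
    both carry the coefficient 1/2 ([jet_bracket_pointwise]). *)

Local Open Scope sdg_scope.
Local Open Scope module_scope.

Section EqualityOnProducts.
Variables (R : QAlgebra) (E : RModule R) (euc : Euclidean E).

(** By the Euclidean property both functions are affine.  Their values at 0
    agree because [0 = 0 * 0], and then cancelling these values leaves equal
    multiples of the slopes by every [e1 * e2]. *)
Lemma eq_on_products (f h : D R 1 -> E) :
  (forall e1 e2 : D R 1, f (Dmul e1 e2) = h (Dmul e1 e2)) ->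
  forall e, f e = h e.
Proof.
intros fh.
destruct (euc f) as [b [hb _]], (euc h) as [c [hc _]].
assert (f0 : f D0 = h D0).
{ assert (z : Dmul (D0 : D R 1) D0 = D0).
  { apply D_eq. cbn. apply (Rmul_0_l (Eqsth R) (Eq_ext _ _ _) (cr_laws R)). }
  rewrite <- z. apply fh. }
assert (bc : b = c).
{ apply (eucl_inj2 euc). intros e1 e2. apply (@maddI R E (f D0)).
  generalize (fh e1 e2). rewrite hb, hc, <- f0. exact (fun h => h). }
intros e. rewrite hb, hc, f0, bc. reflexivity.
Qed.
End EqualityOnProducts.

Section JetBracket.
Variables (R : Line) (g : LieAlgebra R).
Add Ring R_ring_jb : (cr_laws R) (morphism (ofQ_morph R), constants [qcst]).
Add Ring te_ring_jb : (cr_laws (te g))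
  (morphism (ofQ_morph (te g)), constants [qcst]).

Lemma jet_tangentE (X1 X2 X3 : g) (e : D R 1) :
  jet_tangent X1 X2 X3 e = jet (e *: X1) (e *: X2) (e *: X3).
Proof.
apply exp0_eq; intros d. cbn. unfold jet_tangent_fun, jet_fun. te_push. ring.
Qed.

Lemma tangent_eq (Z Z' : Tangent1 (jet_group g)) :
  (forall (e : D R 1) (d : D R 3), exp0_fun (Z e) d = exp0_fun (Z' e) d) ->
  Z = Z'.
Proof.
intros h. destruct Z as [Z hZ], Z' as [Z' hZ']; cbn in h.
assert (Z = Z')
  by (apply functional_extensionality; intros e; apply exp0_eq, h).
subst Z'. f_equal; apply proof_irrelevance.
Qed.

(** The commutators determine the bracket: for fixed [d], evaluation at [d]
    turns a tangent vector of the jet group into a function [D R 1 -> g]. *)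
Lemma group_bracket_of_commutator (X Y Z : Tangent1 (jet_group g)) :
  (forall e1 e2 : D R 1,
     Z (Dmul e1 e2) = (X e1 * Y e2 * X (Dopp e1) * Y (Dopp e2))%G) ->
  is_group_bracket X Y Z.
Proof.
intros hZ. split; [exact hZ |]. intros Z' hZ'.
apply tangent_eq. intros e d.
apply (@eq_on_products R g (@lie_euclidean R g)
  (fun e => exp0_fun (Z e) d) (fun e => exp0_fun (Z' e) d)).
intros e1 e2. rewrite hZ, hZ'. reflexivity.
Qed.

(** Nilpotency in the square-zero extension, as a hypothesis for [ring] after
    [te_push]. *)
Lemma iR_nilpotent n (d : D R n) : (iR g d ^ S n = 0)%S.
Proof.
assert (h : forall m, iR g (d ^ m)%S = (iR g d ^ m)%S).
{ induction m as [| m IH]; [reflexivity |].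
  cbn [rpow]. rewrite iRM, IH. reflexivity. }
rewrite <- h. exact (f_equal (iR g) (proj2_sig d)).
Qed.

(** The group inverses are [X (- e1)] and [Y (- e2)], so the left-hand side is a
    commutator; each factor 2 or 3 arises because [P * Q * P^-1 * Q^-1] picks up
    the antisymmetric part of the product, [1 - (-1)] times the bracket terms
    [[X1, Y1]] and [3/2 ([X1, Y2] + [X2, Y1])]. *)
Lemma jet_tangent_commutator (X1 X2 X3 Y1 Y2 Y3 : g) (e1 e2 : D R 1) :
  let X : Tangent1 (jet_group g) := jet_tangent X1 X2 X3 in
  let Y : Tangent1 (jet_group g) := jet_tangent Y1 Y2 Y3 in
  (X e1 * Y e2 * X (Dopp e1) * Y (Dopp e2))%G =
  jet_tangent 0 (ofQ R 2 *: [X1, Y1]) (ofQ R 3 *: ([X1, Y2] + [X2, Y1]))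
    (Dmul e1 e2).
Proof.
intros X Y. subst X Y. rewrite !jet_tangentE.
cbn [gmul jet_group]. rewrite jet_mulE. unfold jet_mul_coefs.
rewrite jet_mulE. unfold jet_mul_coefs. rewrite jet_mulE. unfold jet_mul_coefs.
generalize (iR_nilpotent 1 e1) (iR_nilpotent 1 e2).
unfold Dmul, Dopp. cbn [Dval proj1_sig rpow]. fold (Dval e1) (Dval e2).
intros h1 h2.
f_equal.
- te_push. ring.
- repeat progress br_push.
  (* [ring] takes brackets as atoms, so antisymmetry is used up here by giving
     every bracket one orientation; likewise for the third coefficient. *)
  rewrite ?(brC Y1 X1). te_push. ring [h1 h2].
- repeat progress br_push.
  rewrite ?(brC Y1 X1), ?(brC Y2 X1), ?(brC Y1 X2), ?(brC Y2 Y1), ?(brC X2 X1).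
  repeat progress br_push. te_push. ring [h1 h2].
Qed.

Lemma jet_bracket_pointwise (X1 X2 X3 Y1 Y2 Y3 : g) (d : D R 3) :
  [jet X1 X2 X3 d, jet Y1 Y2 Y3 d] =
  (d ^ 2)%S *: [X1, Y1] + (ofQ R (1#2) * d ^ 3)%S *: ([X1, Y2] + [X2, Y1]).
Proof.
cbn [jet exp0_fun proj1_sig]. unfold jet_fun.
generalize (iR_nilpotent 3 d). cbn [rpow]. intros h.
repeat progress br_push. te_push. ring [h].
Qed.

Lemma jet_tangent_bracketE (A B : g) (e : D R 1) (d : D R 3) :
  exp0_fun (jet_tangent 0 (ofQ R 2 *: A) (ofQ R 3 *: B) e) d =
  e *: ((d ^ 2)%S *: A + (ofQ R (1#2) * d ^ 3)%S *: B).
Proof. cbn. unfold jet_tangent_fun. te_push. ring. Qed.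

Lemma scale_jet_terms (A B : g) (e d : R) :
  e *: ((d ^ 2)%S *: A + (ofQ R (1#2) * d ^ 3)%S *: B) =
  (d ^ 2 * e)%S *: A + (ofQ R (1#2) * d ^ 3 * e)%S *: B.
Proof. te_push. ring. Qed.
End JetBracket.

Theorem theorem33 (R : Line) (g : LieAlgebra R) (X1 X2 X3 Y1 Y2 Y3 : g) :
  let H := jet_group g in
  let X : Tangent1 H := jet_tangent X1 X2 X3 in
  let Y : Tangent1 H := jet_tangent Y1 Y2 Y3 in
  let gD3 : LieAlgebra R := exp_lie (D R 3) g in
  let x : gD3 := exp0_fun (jet X1 X2 X3) in
  let y : gD3 := exp0_fun (jet Y1 Y2 Y3) in
  exists Z : Tangent1 H,
    is_group_bracket X Y Z /\
    (forall (e : D R 1) (d : D R 3),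
       exp0_fun (Z e) d =
         (d ^ 2 * e)%S *: [X1, Y1]
         + (ofQ R (1#2) * d ^ 3 * e)%S *: ([X1, Y2] + [X2, Y1])) /\
    (forall d : D R 3,
       ([x, y] : D R 3 -> g) d =
         (d ^ 2)%S *: [X1, Y1]
         + (ofQ R (1#2) * d ^ 3)%S *: ([X1, Y2] + [X2, Y1])) /\
    (forall (e : D R 1) (d : D R 3),
       exp0_fun (Z e) d = e *: ([x, y] : D R 3 -> g) d).
Proof.
intros H X Y gD3 x y.
exists (jet_tangent 0 (ofQ R 2 *: [X1, Y1]) (ofQ R 3 *: ([X1, Y2] + [X2, Y1]))).
refine (conj _ (conj _ (conj _ _))).
- apply group_bracket_of_commutator. intros e1 e2.
  symmetry. apply jet_tangent_commutator.
- intros e d. rewrite <- scale_jet_terms. apply jet_tangent_bracketE.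
- apply jet_bracket_pointwise.
- intros e d.
  change (([x, y] : D R 3 -> g) d) with ([jet X1 X2 X3 d, jet Y1 Y2 Y3 d]).
  rewrite jet_bracket_pointwise. apply jet_tangent_bracketE.
Qed.
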